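(* Let $G$ be a finite simple graph with vertex set $\{x_1,\ldots,x_n\}$ and let $\alpha=(a_1,\ldots,a_n,b)$ be a vector in $\{0,1\}^n\times\mathbb{N}$. Then $\alpha$ is an element of the minimal integral Hilbert basis of the Simis cone ${\rm Cn}(I(G))$ if and only if the induced subgraph $H=\langle\{x_i\mid a_i=1\}\rangle$ is irreducible and $b=\alpha_0(H)$.
   Context: $\mathbb{N}=\{0,1,2,\ldots\}$. A vertex cover of $G$ is a set of vertices meeting every edge; let $C_1,\ldots,C_s$ be the (inclusion-)minimal vertex covers of $G$ and let $u_k=\sum_{x_i\in C_k}e_i\in\{0,1\}^n$ be the incidence vector of $C_k$. The Simis cone of the edge ideal $I(G)$ is $${\rm Cn}(I(G))=\{y\in\mathbb{R}^{n+1}\mid y_i\geq 0 \text{ for } 1\leq i\leq n+1,\ \langle y,(u_k,-1)\rangle\geq 0\text{ for }1\leq k\leq s\}.$$ A Hilbert basis of ${\rm Cn}(I(G))$ is a finite set $\mathcal{H}\subset\mathbb{N}^{n+1}$ such that ${\rm Cn}(I(G))=\mathbb{R}_+\mathcal{H}$ (the cone of nonnegative real combinations of $\mathcal{H}$) and $\mathbb{Z}^{n+1}\cap\mathbb{R}_+\mathcal{H}=\mathbb{N}\mathcal{H}$ (the additive semigroup generated by $\mathcal{H}$). There is a unique Hilbert basis that is minimal with respect to inclusion; it is called the minimal integral Hilbert basis. $\langle S\rangle$ is the induced subgraph on the vertex set $S$. The vertex covering number $\alpha_0(H)$ is the minimum cardinality of a vertex cover of $H$ ($0$ if $H$ has no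 edges). A graph $H$ (with nonempty vertex set) is reducible if there are induced subgraphs $H_1,H_2$ of $H$ with nonempty vertex sets such that $V(H)$ is the disjoint union of $V(H_1)$ and $V(H_2)$ and $\alpha_0(H)=\alpha_0(H_1)+\alpha_0(H_2)$; it is irreducible if it is not reducible. The graph with empty vertex set is not regarded as irreducible. *)

(* Defs.v *)
From HB Require Import structures.
From mathcomp Require Import all_boot all_order all_algebra.

Set Implicit Arguments.
Unset Strict Implicit.
Unset Printing Implicit Defensive.

Import GRing.Theory Num.Theory.

(* A simple graph is a symmetric irreflexive relation on a finType. *)

Definition vertex_cover (T : finType) (e : rel T) (C : {set T}) : bool :=
  [forall x, forall y, e x y ==> (x \in C) || (y \in C)].

Definition minimal_vertex_cover (T : finType) (e : rel T) (C : {set T}) : bool :=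
  minset (vertex_cover e) C.

Definition alpha0 (T : finType) (e : rel T) : nat :=
  #|[arg min_(C < [set: T] | vertex_cover e C) #|C|]|.

Definition induced (T : finType) (e : rel T) (S : {set T}) : rel {x : T | x \in S} :=
  relpre val e.

Arguments induced {T} e S _ _.

Definition reducible_graph (T : finType) (e : rel T) : Prop :=
  exists S1 S2 : {set T},
    [/\ S1 != set0, S2 != set0, [disjoint S1 & S2],
        S1 :|: S2 = [set: T]
      & alpha0 e = (alpha0 (induced e S1) + alpha0 (induced e S2))%N].

Definition irreducible_graph (T : finType) (e : rel T) : Prop :=
  (0 < #|T|)%N /\ ~ reducible_graph e.

(* [classical_sets] reuses the notations of [finset] for its own sets, hence the
   late import. *)
From mathcomp Require Import finmap.
From mathcomp Require Import classical_sets reals.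

Local Open Scope classical_set_scope.
Local Open Scope ring_scope.

Definition dotp (R : realType) (m : nat) (y z : 'rV[R]_m) : R :=
  \sum_(i < m) y 0 i * z 0 i.

Definition incidence_vector (R : realType) (n : nat) (C : {set 'I_n}) : 'rV[R]_n :=
  \sum_(i in C) delta_mx 0 i.

Definition simis_cone (R : realType) (n : nat) (e : rel 'I_n) : set 'rV[R]_(n + 1) :=
  [set y : 'rV[R]_(n + 1) | (forall i, 0 <= y 0 i) /\
           forall C, minimal_vertex_cover e C ->
             0 <= dotp y (row_mx (incidence_vector R C) (const_mx (-1)))].

Arguments simis_cone R {n} e _.

Definition natv (R : realType) (m : nat) (h : 'rV[nat]_m) : 'rV[R]_m :=
  map_mx (fun k : nat => k%:R) h.

Definition int_lattice (R : realType) (m : nat) : set 'rV[R]_m :=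
  range (fun z : 'rV[int]_m => map_mx (fun k : int => k%:~R) z).

Definition real_cone (R : realType) (m : nat) (H : {fset 'rV[nat]_m}) : set 'rV[R]_m :=
  [set y : 'rV[R]_m | exists c : 'rV[nat]_m -> R,
     (forall h, 0 <= c h) /\ y = \sum_(h <- H) c h *: natv R h].

Definition nat_span (R : realType) (m : nat) (H : {fset 'rV[nat]_m}) : set 'rV[R]_m :=
  [set y : 'rV[R]_m | exists c : 'rV[nat]_m -> nat, y = \sum_(h <- H) natv R h *+ c h].

Arguments int_lattice : clear implicits.
Arguments real_cone {R m} H _.
Arguments nat_span {R m} H _.

Definition hilbert_basis (R : realType) (m : nat) (K : set 'rV[R]_m)
    (H : {fset 'rV[nat]_m}) : Prop :=
  K = real_cone H /\ int_lattice R m `&` real_cone H = nat_span H.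

Definition is_minimal_hilbert_basis (R : realType) (m : nat) (K : set 'rV[R]_m)
    (H : {fset 'rV[nat]_m}) : Prop :=
  hilbert_basis K H /\
  forall H' : {fset 'rV[nat]_m}, hilbert_basis K H' -> fsubset H' H -> H' = H.

(* Definite description; the default value [fset0] occurs only for a cone
   without Hilbert basis, and every Simis cone has one. *)
Definition minimal_hilbert_basis (R : realType) (m : nat) (K : set 'rV[R]_m) :
    {fset 'rV[nat]_m} :=
  xget fset0 [set H | is_minimal_hilbert_basis K H].

(* Main.v *)
(* A polyhedral cone [K] cut out of the orthant by integer half-spaces is
   generated by finitely many vectors of N^m (double description, one half-space
   at a time), so its nonzero lattice points that are not a sum of two such
   points are bounded, hence finite in number; they span the semigroup of lattice
   points and lie in every Hilbert basis, so they form the minimal one.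
   A lattice point (1_S, b) lies in the Simis cone iff b <= alpha0(S). Lowering b
   strictly below alpha0(S) lets one vertex be split off, and for b = alpha0(S) a
   decomposition of (1_S, b) is a partition of S along which the superadditive
   function alpha0 is additive. *)

Require Import Defs.
From mathcomp Require Import all_boot all_order all_algebra.
From mathcomp Require Import finmap.
From mathcomp Require Import classical_sets reals.
From mathcomp Require Import boolp zify ring lra.

Set Implicit Arguments.
Unset Strict Implicit.
Unset Printing Implicit Defensive.

Import Order.TTheory GRing.Theory Num.Theory.

Local Open Scope ring_scope.

(** * Cones and semigroups generated by finitely many vectors of N^m *)

Section NatVectors.
Variables (R : realType) (m : nat).
Implicit Types (h : 'rV[nat]_m) (H : {fset 'rV[nat]_m}).

Lemma natv0 : natv R (0 : 'rV[nat]_m) = 0.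
Proof. by apply/rowP => i; rewrite !mxE. Qed.

Lemma natvD h1 h2 : natv R (h1 + h2) = natv R h1 + natv R h2.
Proof. by apply/rowP => i; rewrite !mxE natrD. Qed.

Lemma natvMn h k : natv R (h *+ k) = natv R h *+ k.
Proof. by elim: k => [|k IH]; rewrite ?natv0 // !mulrS natvD IH. Qed.

Lemma natv_sum I (s : seq I) (F : I -> 'rV[nat]_m) :
  natv R (\sum_(i <- s) F i) = \sum_(i <- s) natv R (F i).
Proof. exact: (big_morph _ natvD natv0). Qed.

Lemma natv_inj : injective (@natv R m).
Proof.
move=> h1 h2 /rowP eq_h; apply/rowP => i.
by have /eqP := eq_h i; rewrite !mxE eqr_nat => /eqP.
Qed.

Lemma natv_lattice h : int_lattice R m (natv R h).
Proof. by exists (map_mx Posz h) => //; apply/rowP => i; rewrite !mxE. Qed.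

Definition convex_cone (K : set 'rV[R]_m) :=
  [/\ K 0, forall x y, K x -> K y -> K (x + y)
    & forall c x, 0 <= c -> K x -> K (c *: x)].

Lemma convex_cone_sum (K : set 'rV[R]_m) (I : eqType) (s : seq I) (P : pred I)
    (F : I -> 'rV[R]_m) :
  convex_cone K -> (forall i, i \in s -> P i -> K (F i)) ->
  K (\sum_(i <- s | P i) F i).
Proof.
case=> K0 KD _ KF; rewrite big_seq_cond.
by apply: big_ind => // i /andP[/KF]; apply.
Qed.

Lemma real_cone_convex H : convex_cone (@real_cone R m H).
Proof.
split.
- exists (fun=> 0); split=> //.
  by rewrite big1 // => i _; rewrite scale0r.
- move=> _ _ [c [c0 ->]] [d [d0 ->]]; exists (fun h => c h + d h); split.
    by move=> h; rewrite addr_ge0.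
  by rewrite -big_split /=; apply: eq_bigr => h _; rewrite scalerDl.
- move=> k _ k0 [c [c0 ->]]; exists (fun h => k * c h); split.
    by move=> h; rewrite mulr_ge0.
  by rewrite scaler_sumr; apply: eq_bigr => h _; rewrite scalerA.
Qed.

Lemma mem_real_cone H h : h \in H -> real_cone H (natv R h).
Proof.
move=> hH; exists (fun x => (x == h)%:R); split=> [x|]; first exact: ler0n.
rewrite (bigD1_seq h hH (fset_uniq H)) /= eqxx scale1r.
rewrite big1 ?addr0 // => x /negbTE->.
by rewrite scale0r.
Qed.

Lemma real_cone_sub H (K : set 'rV[R]_m) : convex_cone K ->
  (forall h, h \in H -> K (natv R h)) -> (real_cone H `<=` K)%classic.
Proof.
move=> Kc HK _ [c [c0 ->]]; apply: (convex_cone_sum Kc) => h /HK Kh _.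
by case: Kc => _ _; apply.
Qed.

Lemma nat_span_natv H x : @nat_span R m H x <->
  exists2 h, x = natv R h &
    exists c : 'rV[nat]_m -> nat, h = \sum_(g <- H) g *+ c g.
Proof.
split=> [[c ->]|[h -> [c ->]]].
  exists (\sum_(g <- H) g *+ c g); last by exists c.
  by rewrite natv_sum; apply: eq_bigr => g _; rewrite natvMn.
by exists c; rewrite natv_sum; apply: eq_bigr => g _; rewrite natvMn.
Qed.

Lemma nat_span0 H : @nat_span R m H 0.
Proof. by exists (fun=> 0%N); rewrite big1. Qed.

Lemma nat_spanD H x y :
  @nat_span R m H x -> nat_span H y -> nat_span H (x + y).
Proof.
move=> [c ->] [d ->]; exists (fun h => c h + d h)%N.
by rewrite -big_split /=; apply: eq_bigr => h _; rewrite mulrnDr.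
Qed.

Lemma mem_nat_span H h : h \in H -> nat_span H (natv R h).
Proof.
move=> hH; exists (fun x => (x == h) : nat).
by rewrite (bigD1_seq h hH (fset_uniq H)) /= eqxx big1 ?addr0 // => x /negbTE->.
Qed.

Lemma nat_span_real_cone H : (@nat_span R m H `<=` real_cone H)%classic.
Proof.
move=> _ [c ->]; exists (fun h => (c h)%:R); split=> //.
by apply: eq_bigr => h _; rewrite scaler_nat.
Qed.

End NatVectors.

(** * Finite generation of integer polyhedral cones in the orthant *)

Section PolyhedralCone.
Variables (R : realType) (m : nat).
Implicit Types (h g : 'rV[nat]_m) (w : 'rV[int]_m) (H : {fset 'rV[nat]_m}).

(** The orthant inequalities are built in, so that every lattice point of the cone comes from a
    vector of N^m. *)
Definition polyhedral_cone (ws : seq 'rV[int]_m) : set 'rV[R]_m :=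
  [set y : 'rV[R]_m | (forall i, 0 <= y 0 i) /\
     forall w, w \in ws -> 0 <= dotp y (map_mx intr w)]%classic.

Lemma dotpDl (x y z : 'rV[R]_m) : dotp (x + y) z = dotp x z + dotp y z.
Proof.
by rewrite /dotp -big_split; apply: eq_bigr => i _; rewrite mxE mulrDl.
Qed.

Lemma dotp0l (z : 'rV[R]_m) : dotp 0 z = 0.
Proof. by rewrite /dotp big1 // => i _; rewrite mxE mul0r. Qed.

Lemma dotpZl k (x z : 'rV[R]_m) : dotp (k *: x) z = k * dotp x z.
Proof.
by rewrite /dotp mulr_sumr; apply: eq_bigr => i _; rewrite mxE mulrA.
Qed.

Lemma dotp_suml I (s : seq I) (P : pred I) (F : I -> 'rV[R]_m) z :
  dotp (\sum_(i <- s | P i) F i) z = \sum_(i <- s | P i) dotp (F i) z.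
Proof.
by apply: (big_morph (fun x => dotp x z)) => [x y|]; rewrite ?dotpDl ?dotp0l.
Qed.

Lemma polyhedral_cone_convex ws : convex_cone (polyhedral_cone ws).
Proof.
split.
- by split=> [i|w _]; rewrite ?mxE ?dotp0l.
- move=> x y [x0 xw] [y0 yw]; split=> [i|w ws_w].
    by rewrite mxE addr_ge0.
  by rewrite dotpDl addr_ge0 ?xw ?yw.
- move=> k x k0 [x0 xw]; split=> [i|w ws_w].
    by rewrite mxE mulr_ge0.
  by rewrite dotpZl mulr_ge0 ?xw.
Qed.

Definition pairing w h : int := \sum_i (h 0 i)%:Z * w 0 i.

Lemma dotp_natv w h : dotp (natv R h) (map_mx intr w) = (pairing w h)%:~R.
Proof.
rewrite /dotp /pairing rmorph_sum; apply: eq_bigr => i _.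
by rewrite !mxE rmorphM.
Qed.

(** Absolute values keep the vector in N^m. For [g] on the nonnegative side of [w] and [h] on the
    negative side, this is a point of their cone on the hyperplane orthogonal to [w]. *)
Definition cross w g h : 'rV[nat]_m :=
  h *+ `|pairing w g|%N + g *+ `|pairing w h|%N.

(** One step of double description: the generators on the negative side give way to the points where
    their segments to the other generators cross the hyperplane. *)
Definition cut w H : {fset 'rV[nat]_m} :=
  seq_fset tt ([seq h <- H | 0 <= pairing w h] ++
     [seq cross w g h | g <- [seq g <- H | 0 <= pairing w g],
                        h <- [seq h <- H | pairing w h < 0]]).

Lemma natv_cross w g h : 0 <= pairing w g -> pairing w h < 0 ->
  natv R (cross w g h) =
  (pairing w g)%:~R *: natv R h - (pairing w h)%:~R *: natv R g.
Proof.
rewrite /cross natvD !natvMn => g0 h0.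
rewrite -!scaler_nat -scaleNr; congr (_ *: _ + _ *: _).
  by rewrite natr_absz ger0_norm.
by rewrite natr_absz ltr0_norm // rmorphN.
Qed.

Lemma real_cone_cut w H : real_cone (cut w H) =
  (real_cone H `&` [set y | 0 <= dotp y (map_mx intr w : 'rV[R]_m)])%classic.
Proof.
apply/seteqP; split.
  apply: real_cone_sub.
    have [r0 rD rZ] := real_cone_convex R H; split.
    - by split=> //=; rewrite dotp0l.
    - move=> x y [? /= ?] [? /= ?]; split=> /=; first exact: rD.
      by rewrite dotpDl addr_ge0.
    - move=> k x k0 [? /= ?]; split=> /=; first exact: rZ.
      by rewrite dotpZl mulr_ge0.
  move=> x; rewrite seq_fsetE mem_cat mem_filter => /orP[/andP[x0 xH]|].
    by split; [exact: mem_real_cone|rewrite /= dotp_natv ler0z].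
  case/allpairsP => -[g h] /=; rewrite !mem_filter.
  move=> [/andP[g0 gH] /andP[h0 hH] ->]; have [r0 rD rZ] := real_cone_convex R H.
  rewrite natv_cross //; split => /=.
    rewrite -scaleNr; apply: rD; apply: rZ; try exact: mem_real_cone.
      by rewrite ler0z.
    by rewrite oppr_ge0 lerz0 ltW.
  rewrite -scaleNr dotpDl !dotpZl !dotp_natv.
  by rewrite mulNr mulrC subrr.
move=> y [[c [c0 ->]]] /=.
set p := fun h => (pairing w h)%:~R : R.
pose P h := 0 <= pairing w h.
have [r0 rD rZ] := real_cone_convex R (cut w H).
have rP k h : 0 <= k -> h \in H -> P h -> real_cone (cut w H) (k *: natv R h).
  move=> k0 hH Ph; apply: rZ => //; apply: mem_real_cone.
  by rewrite seq_fsetE mem_cat mem_filter -/(P h) Ph hH.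
have rX k g h : 0 <= k -> g \in H -> h \in H -> P g -> ~~ P h ->
    real_cone (cut w H) (k *: (p g *: natv R h - p h *: natv R g)).
  rewrite /P -ltNge => k0 gH hH Pg Ph.
  rewrite -natv_cross //; apply: rZ => //; apply: mem_real_cone.
  rewrite seq_fsetE mem_cat; apply/orP; right.
  by apply: allpairs_f; rewrite mem_filter ?Pg ?Ph ?gH ?hH.
rewrite dotp_suml (bigID P) /= [X in _ -> real_cone _ X](bigID P) /=.
set s := \sum_(i <- H | P i) dotp _ _; set t := \sum_(i <- H | ~~ P i) dotp _ _.
set X := \sum_(i <- H | P i) _; set Y := \sum_(i <- H | ~~ P i) _ => st0.
have sE : s = \sum_(i <- H | P i) c i * p i.
  by apply: eq_bigr => i _; rewrite dotpZl dotp_natv.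
have tE : t = \sum_(i <- H | ~~ P i) c i * p i.
  by apply: eq_bigr => i _; rewrite dotpZl dotp_natv.
have t_le i : ~~ P i -> 0 <= - (c i * p i).
  by rewrite /P -ltNge -mulrN => pi; rewrite mulr_ge0 // oppr_ge0 lerz0 ltW.
have t0 : 0 <= - t by rewrite tE -sumrN sumr_ge0 // => i; exact: t_le.
(* Here [s + t] is nonnegative and [t] is a sum of nonpositive terms. If [s = 0], all these terms
   vanish; as the pairings in them are nonzero, the coefficients do, and so [Y = 0]. *)
have [s0|s0] := eqVneq s 0.
  have : - t = 0 by apply/eqP; rewrite eq_le t0 andbT; move: st0; rewrite s0; lra.
  rewrite tE -sumrN => /eqP; rewrite psumr_eq0; last by move=> i; exact: t_le.
  move=> /allP allH; have -> : Y = 0.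
    rewrite /Y big_seq_cond big1 // => i /andP[iH Pi].
    have := allH i iH; rewrite Pi /= oppr_eq0 mulf_eq0 => /orP[/eqP->|].
      by rewrite scale0r.
    by rewrite /p intr_eq0 => /eqP p0; move: Pi; rewrite /P p0.
  rewrite addr0; apply: (convex_cone_sum (real_cone_convex R _)) => h hH Ph.
  exact: rP.
have s_gt0 : 0 < s.
  rewrite lt0r s0 sE sumr_ge0 // => i Pi.
  by rewrite mulr_ge0 // ler0z.
(* The part of [X] with the same pairing as [- Y] is absorbed, together with
   [Y], by the vectors [cross w g h], which lie on the hyperplane. *)
have -> : X + Y = (1 + t / s) *: X + \sum_(g <- H | P g) \sum_(h <- H | ~~ P h)
    (s^-1 * c g * c h) *: (p g *: natv R h - p h *: natv R g).
  rewrite scalerDl scale1r -addrA; congr (_ + _).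
  under eq_bigr => g _.
    under eq_bigr => h _ do rewrite scalerBr !scalerA.
    rewrite sumrB; over.
  rewrite sumrB exchange_big /=.
  have -> : \sum_(h <- H | ~~ P h) \sum_(g <- H | P g)
      (s^-1 * c g * c h * p g) *: natv R h = Y.
    apply: eq_bigr => h _; rewrite -scaler_suml; congr (_ *: _).
    transitivity (s^-1 * c h * s); last by field.
    by rewrite [X in _ = _ * X]sE mulr_sumr; apply: eq_bigr => g _; ring.
  have -> : \sum_(g <- H | P g) \sum_(h <- H | ~~ P h)
      (s^-1 * c g * c h * p h) *: natv R g = (t / s) *: X.
    rewrite scaler_sumr; apply: eq_bigr => g _; rewrite -scaler_suml scalerA.
    congr (_ *: _); rewrite tE !mulr_suml; apply: eq_bigr => h _.
    by ring.
  by rewrite addrCA subrr addr0.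
apply: rD.
  (* The factor [1 + t / s] is [(s + t) / s], hence nonnegative. *)
  apply: rZ; first by rewrite -[1](divff s0) -mulrDl divr_ge0 // ltW.
  by apply: (convex_cone_sum (real_cone_convex R _)) => h hH Ph; apply: rP.
apply: (convex_cone_sum (real_cone_convex R _)) => g gH Pg.
apply: (convex_cone_sum (real_cone_convex R _)) => h hH Ph.
by apply: rX; rewrite ?mulr_ge0 ?invr_ge0 // ltW.
Qed.

Lemma polyhedral_cone_fg ws : exists H, polyhedral_cone ws = real_cone H.
Proof.
elim: ws => [|w ws [H eqH]].
  exists (seq_fset tt [seq delta_mx 0 i | i : 'I_m]).
  apply/seteqP; split=> y.
    case=> y0 _; rewrite (row_sum_delta y).
    have [_ _ rZ] := real_cone_convex R
      (seq_fset tt [seq delta_mx 0 i | i : 'I_m]).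
    apply: (convex_cone_sum (real_cone_convex R _)) => i _ _; apply: rZ => //.
    have -> : delta_mx 0 i = natv R (delta_mx 0 i : 'rV[nat]_m).
      by apply/rowP => j; rewrite !mxE natn.
    by apply: mem_real_cone; rewrite seq_fsetE; apply: map_f; rewrite mem_enum.
  apply: real_cone_sub; first exact: polyhedral_cone_convex.
  by move=> h _; split=> // i; rewrite mxE.
exists (cut w H); rewrite real_cone_cut -eqH; apply/seteqP; split=> y.
  case=> y0 yw; split; last by apply: yw; rewrite mem_head.
  by split=> // v vws; apply: yw; rewrite inE vws orbT.
by case=> -[y0 yw] /= ywy; split=> // v; rewrite inE => /orP[/eqP->|/yw].
Qed.

(** * Indecomposable lattice points and the minimal Hilbert basis *)

Definition indecomposable (M : 'rV[nat]_m -> Prop) h :=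
  [/\ M h, h != 0
    & forall h1 h2, M h1 -> M h2 -> h = h1 + h2 -> h1 = 0 \/ h2 = 0].

(** Separate the first term from the rest: one of the two vanishes. If the rest does, [h] is a
    positive multiple of [g], and splitting off one copy of [g] leaves only [h = g]. *)
Lemma indecomposable_mem_sum (M : 'rV[nat]_m -> Prop) h (s : seq 'rV[nat]_m)
    (c : 'rV[nat]_m -> nat) : M 0 -> (forall x y, M x -> M y -> M (x + y)) ->
  (forall g, g \in s -> M g) -> indecomposable M h ->
  h = \sum_(g <- s) g *+ c g -> h \in s.
Proof.
move=> M0 MD sM [_ hn0 hP] hE.
have MX g k : M g -> M (g *+ k).
  by move=> Mg; elim: k => // k IH; rewrite mulrS; apply: MD.
elim: s sM hE => [_|g s IH sM].
  by rewrite big_nil => h0; rewrite h0 eqxx in hn0.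
have Mg : M g by apply: sM; rewrite mem_head.
have {sM} Ms x : x \in s -> M x by move=> xs; apply: sM; rewrite inE xs orbT.
rewrite big_cons => hE.
have Msum : M (\sum_(x <- s) x *+ c x).
  by rewrite big_seq; apply: big_ind => // x /Ms; apply: MX.
case: (hP _ _ (MX g (c g) Mg) Msum hE) => [z|z]; rewrite inE.
  by rewrite IH ?orbT // hE z add0r.
move: hE; rewrite z addr0; case: (c g) => [|k] hE.
  by rewrite hE eqxx in hn0.
rewrite mulrS in hE; case: (hP _ _ Mg (MX g k Mg) hE) => z'.
  by move: hn0; rewrite hE z' mul0rn addr0 eqxx.
by rewrite hE z' addr0 eqxx.
Qed.

Section FixedCone.
Variable ws : seq 'rV[int]_m.
Let K := polyhedral_cone ws.
Let M h := K (natv R h).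

Let M0 : M 0. Proof. by rewrite /M natv0; case: (polyhedral_cone_convex ws). Qed.
Let MD x y : M x -> M y -> M (x + y).
Proof. by rewrite /M natvD; case: (polyhedral_cone_convex ws) => _ + _; apply. Qed.

Lemma lattice_polyhedral_cone x : int_lattice R m x -> K x ->
  exists2 h, x = natv R h & M h.
Proof.
case=> z _ <- Kz; exists (map_mx absz z); last first.
  rewrite /M; suff -> : natv R (map_mx absz z) = map_mx intr z by [].
  apply/rowP => i; rewrite !mxE natr_absz ger0_norm //.
  by case: Kz => /(_ i); rewrite mxE ler0z.
apply/rowP => i; rewrite !mxE natr_absz ger0_norm //.
by case: Kz => /(_ i); rewrite mxE ler0z.
Qed.

(* A generator with coefficient at least 1 could be split off, so all
   coefficients of an indecomposable vector that is not a generator are < 1. *)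
Lemma indecomposable_bounded :
  exists B, forall h, indecomposable M h -> forall i, (h 0%R i <= B)%N.
Proof.
have [H eqH] := polyhedral_cone_fg ws.
(* With coefficients below 1, coordinate [i] is at most the sum of the coordinates [i] of the
   generators; the outer sum makes the bound independent of [i]. *)
exists (\sum_i \sum_(g <- H) g 0%R i)%N => h hM i.
apply: (@leq_trans (\sum_(g <- H) g 0%R i)); last first.
  by rewrite [leqRHS](bigD1 i) ?leq_addr.
have [hH|hH] := boolP (h \in H); first by rewrite (big_rem h) //= leq_addr.
have [Mh hn0 hP] := hM.
have MH g : g \in H -> M g.
  by move=> gH; rewrite /M /K eqH; apply: mem_real_cone.
have : K (natv R h) by [].
rewrite /K eqH => -[c [c0 hE]].
have c1 g : g \in H -> g != 0 -> c g < 1.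
  move=> gH gn0; rewrite ltNge; apply/negP => cg.
  have Kg : K (natv R h - natv R g).
    rewrite hE (bigD1_seq g gH (fset_uniq H)) /= addrAC.
    rewrite -[X in _ - X]scale1r -scalerBl.
    have [_ KD KZ] := polyhedral_cone_convex ws.
    apply: KD; first by apply: KZ; [rewrite subr_ge0|apply: MH].
    apply: convex_cone_sum; first exact: polyhedral_cone_convex.
    by move=> x xH _; apply: KZ => //; apply: MH.
  (* As [h - g] lies in the orthant, the truncated subtraction that defines [d] is exact. *)
  have le_gh j : (g 0%R j <= h 0%R j)%N.
    by case: Kg => /(_ j) + _; rewrite !mxE subr_ge0 ler_nat.
  pose d := \row_j (h 0%R j - g 0%R j)%N.
  have hgd : h = g + d by apply/rowP => j; rewrite !mxE /GRing.add /= subnKC.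
  have Md : M d by rewrite /M; move: Kg; rewrite hgd natvD addrC addKr.
  case: (hP g d (MH g gH) Md hgd) => [gz|dz]; first by rewrite gz eqxx in gn0.
  by move: hH; rewrite hgd dz addr0 gH.
rewrite -(ler_nat R); move/rowP/(_ i): hE; rewrite !mxE => ->.
rewrite natr_sum summxE !big_seq; apply: ler_sum => g gH; rewrite !mxE.
(* A zero generator may have a large coefficient, but it contributes nothing. *)
have [->|gn0] := eqVneq g 0; first by rewrite mxE mulr0.
by rewrite ler_piMl // ltW // c1.
Qed.

Lemma indecomposable_finite :
  exists H, forall h, h \in H <-> indecomposable M h.
Proof.
have [B hB] := indecomposable_bounded.
exists (seq_fset tt [seq x <- [seq map_mx val z | z : 'rV['I_B.+1]_m] |
  `[< indecomposable M x >]]) => h.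
rewrite seq_fsetE mem_filter; split=> [/andP[/asboolP]//|hM].
apply/andP; split; first exact/asboolP.
apply/mapP; exists (map_mx inord h); first by rewrite mem_enum.
by apply/rowP => i; rewrite !mxE [RHS]inordK // ltnS hB.
Qed.

(** Strong induction on the coordinate sum. If [h] were not spanned, it would be indecomposable and
    hence in [H]: both parts of a nontrivial decomposition have smaller sums, so they are spanned,
    and [h] with them. *)
Lemma indecomposable_span H : (forall h, h \in H <-> indecomposable M h) ->
  forall h, M h -> nat_span H (natv R h).
Proof.
move=> HP h; have [k] := ubnP (\sum_i h 0%R i)%N.
elim: k h => // k IH h; rewrite ltnS => hk Mh.
have [->|hn0] := eqVneq h 0; first by rewrite natv0; apply: nat_span0.
apply: contrapT => nspan; apply: (nspan); apply: mem_nat_span.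
apply/HP; split=> // h1 h2 Mh1 Mh2 hE.
have [->|h1n0] := eqVneq h1 0; first by left.
have [->|h2n0] := eqVneq h2 0; first by right.
have sum_gt0 (x : 'rV[nat]_m) : x != 0 -> (0 < \sum_i x 0%R i)%N.
  rewrite lt0n; apply: contra; rewrite sum_nat_eq0 => /forallP x0.
  by apply/eqP/rowP => i; rewrite mxE; apply/eqP; apply: x0.
case: nspan; rewrite hE natvD.
have sumE : (\sum_i h 0%R i = \sum_i h1 0%R i + \sum_i h2 0%R i)%N.
  by rewrite -big_split hE; apply: eq_bigr => i _; rewrite mxE.
have := sum_gt0 _ h1n0; have := sum_gt0 _ h2n0; move: hk; rewrite sumE => *.
by apply: nat_spanD; apply: IH => //; lia.
Qed.

(** An indecomposable lattice point is a natural combination of the basis, and such a combination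
    can only be one of its terms. *)
Lemma hilbert_basis_indecomposable H h :
  hilbert_basis K H -> indecomposable M h -> h \in H.
Proof.
case=> eqK eqS hM; have [Mh _ _] := hM.
have : nat_span H (natv R h).
  by rewrite -eqS; split; [exact: natv_lattice|rewrite -eqK].
case/nat_span_natv => _ /natv_inj <- [c hE].
apply: (indecomposable_mem_sum M0 MD _ hM hE) => g gH.
by rewrite /M eqK; apply: mem_real_cone.
Qed.

Lemma indecomposable_hilbert_basis H :
  (forall h, h \in H <-> indecomposable M h) -> hilbert_basis K H.
Proof.
move=> HP; have HK : (real_cone H `<=` K)%classic.
  apply: real_cone_sub; first exact: polyhedral_cone_convex.
  by move=> h /HP[].
have eqK : K = real_cone H.
  (* The generators [G] of the cone are themselves lattice points of it, hence natural combinations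
     of indecomposables. *)
  apply/seteqP; split=> //; have [G eqG] := polyhedral_cone_fg ws.
  rewrite /K eqG; apply: real_cone_sub; first exact: real_cone_convex.
  move=> g gG; apply: nat_span_real_cone; apply: indecomposable_span => //.
  by rewrite /M /K eqG; apply: mem_real_cone.
split=> //; apply/seteqP; split=> [x [xZ]|x xH].
  rewrite -eqK => /(lattice_polyhedral_cone xZ)[h -> Mh].
  exact: indecomposable_span.
split; last exact: nat_span_real_cone.
by case/nat_span_natv: xH => h -> _; apply: natv_lattice.
Qed.

(** The indecomposables form a basis contained in every basis. A minimal basis therefore exists, so
    [xget] does not return its default, and the minimality of the chosen one forces equality. *)
Lemma mem_minimal_hilbert_basis h :
  h \in minimal_hilbert_basis K <-> indecomposable M h.
Proof.
have [H HP] := indecomposable_finite.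
have basH := indecomposable_hilbert_basis HP.
have minH : is_minimal_hilbert_basis K H.
  split=> // H' basH' subH'; apply/eqP; rewrite eqEfsubset subH'.
  by apply/fsubsetP => x /HP; apply: hilbert_basis_indecomposable.
have [basM minM] := xgetPex fset0
  (ex_intro [set H | is_minimal_hilbert_basis K H]%classic H minH).
rewrite -/(minimal_hilbert_basis K) in basM minM.
rewrite -(minM H) //; apply/fsubsetP => x /HP.
exact: hilbert_basis_indecomposable.
Qed.

End FixedCone.
End PolyhedralCone.

(** * The vertex covering number of induced subgraphs *)

Section Covers.

(** Lower bounds on [alpha0] have the same shape as the inequalities of the cone; below, values of
    [alpha0] are compared through them. *)
Lemma alpha0_geP (T : finType) (e : rel T) k :
  (k <= alpha0 e)%N <-> forall C, vertex_cover e C -> (k <= #|C|)%N.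
Proof.
rewrite /alpha0; case: arg_minnP => [|C covC minC].
  by apply/forallP => x; apply/forallP => y; rewrite inE implybT.
split=> [kC D /minC|]; first exact: leq_trans.
exact.
Qed.

Lemma vertex_coverP (T : finType) (e : rel T) (C : {set T}) :
  reflect (forall x y, e x y -> (x \in C) || (y \in C)) (vertex_cover e C).
Proof.
apply: (iffP forallP) => [H x y|H x]; first by have /forallP/(_ y)/implyP := H x.
by apply/forallP => y; apply/implyP/H.
Qed.

(* A cover [D] of the pulled back graph contains the trace of the cover
   [~: f @: ~: D]. *)
Lemma alpha0_relpre_geP (T T' : finType) (e : rel T) (f : T' -> T) k :
  (k <= alpha0 (relpre f e))%N <->
  forall C, vertex_cover e C -> (k <= #|f @^-1: C|)%N.
Proof.
rewrite alpha0_geP; split=> [H C /vertex_coverP covC|H D /vertex_coverP covD].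
  by apply: H; apply/vertex_coverP => x y /= /covC; rewrite !inE.
apply: leq_trans (H (~: (f @: (~: D)))%SET _) _.
  apply/vertex_coverP => x y exy; rewrite !inE -negb_and.
  apply/negP => /andP[/imsetP[x' x'D xE] /imsetP[y' y'D yE]].
  rewrite !inE in x'D y'D; have := covD x' y'.
  by rewrite (negbTE x'D) (negbTE y'D) /= -xE -yE; move/(_ exy).
apply: subset_leq_card; apply/fintype.subsetP => x; rewrite !inE.
by apply: contraR => xD; apply: imset_f; rewrite inE.
Qed.

(** Replaces covers of the subgraph, which live on a sigma type, by traces on [S] of covers of the
    whole graph. *)
Lemma alpha0_induced_geP (T : finType) (e : rel T) (S : {set T}) k :
  (k <= alpha0 (induced e S))%N <->
  forall C, vertex_cover e C -> (k <= #|C :&: S|)%N.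
Proof.
rewrite alpha0_relpre_geP.
suff E (C : {set T}) : #|val @^-1: C : {set {x | x \in S}}| = #|C :&: S|.
  by split=> H C /H; rewrite E.
rewrite -(card_imset _ val_inj); apply: eq_card => x; rewrite !inE.
apply/imsetP/andP => [[y]|[xC xS]].
  by rewrite inE => yC ->; split=> //; exact: valP.
by exists (Sub x xS); rewrite ?inE SubK.
Qed.

(** Reducibility of a subgraph speaks of subsets of its own vertex type; this brings them back to
    subsets of [T]. Both sides have the same lower bounds. *)
Lemma alpha0_induced_induced (T : finType) (e : rel T) (S : {set T})
    (A : {set {x | x \in S}}) :
  alpha0 (induced (induced e S) A) = alpha0 (induced e (val @: A)).
Proof.
suff E k : (k <= alpha0 (induced (induced e S) A))%N <->
           (k <= alpha0 (induced e (val @: A)))%N.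
  by apply/eqP; rewrite eqn_leq (E _).1 // (E _).2.
rewrite (alpha0_relpre_geP e (val \o val)) alpha0_induced_geP.
suff E (C : {set T}) :
    #|(val \o val) @^-1: C : {set {x | x \in A}}| = #|C :&: val @: A|.
  by split=> H C /H; rewrite E.
rewrite -(card_imset _ (inj_comp val_inj val_inj)); apply: eq_card => x.
rewrite !inE; apply/imsetP/andP => [[y]|[xC /imsetP[y yA xE]]].
  by rewrite inE => yC ->; split=> //; apply: imset_f; exact: valP.
by exists (Sub y yA); rewrite ?inE /= ?SubK -xE.
Qed.

Lemma minimal_coverP (T : finType) (e : rel T) (F : {set T} -> nat) k :
  (forall A B : {set T}, A \subset B -> (F A <= F B)%N) ->
  (forall C, minimal_vertex_cover e C -> (k <= F C)%N) <->
  (forall C, vertex_cover e C -> (k <= F C)%N).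
Proof.
move=> Fmono; split=> H C; last by move/minsetp; exact: H.
by case/minset_exists => D minD /Fmono; apply: leq_trans; apply: H.
Qed.

End Covers.

(** * Lattice points of the Simis cone and irreducible subgraphs *)

Section SimisCone.
Variables (n : nat) (e : rel 'I_n).
Implicit Types (S A B C : {set 'I_n}) (a : 'rV[nat]_n) (b : nat).

Definition simis_facets : seq 'rV[int]_(n + 1) :=
  [seq row_mx (\row_i (i \in C)%:R) (const_mx (-1)) |
     C <- enum (minimal_vertex_cover e)].

Lemma incidence_vectorE (R : realType) C :
  incidence_vector R C = \row_i (i \in C)%:R.
Proof.
apply/rowP => i; rewrite /incidence_vector summxE mxE.
under eq_bigr do rewrite mxE eqxx /=.
have [iC|iC] := boolP (i \in C).
  rewrite (bigD1 i) //= eqxx big1 ?addr0 // => j /andP[_ /negbTE].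
  by rewrite eq_sym => ->.
by rewrite big1 // => j jC; case: eqP => // ij; rewrite ij jC in iC.
Qed.

Lemma simis_cone_polyhedral (R : realType) :
  simis_cone R e = polyhedral_cone simis_facets.
Proof.
have mapE C : map_mx intr (row_mx (\row_i (i \in C)%:R) (const_mx (-1))) =
    row_mx (incidence_vector R C) (const_mx (-1)) :> 'rV_(n + 1).
  rewrite map_row_mx map_const_mx incidence_vectorE rmorphN1; congr row_mx.
  by apply/rowP => i; rewrite !mxE; case: (i \in C).
apply/seteqP; split=> y [y0 yC]; split=> //.
  by move=> _ /mapP[C + ->]; rewrite mem_enum mapE => /yC.
by move=> C minC; rewrite -mapE; apply/yC/map_f; rewrite mem_enum.
Qed.

(** A sum of natural coordinates over [C] grows with [C], so the inequalities for minimal covers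
    imply those for all covers. *)
Lemma simis_cone_natv (R : realType) a b :
  simis_cone R e (natv R (row_mx a (const_mx b))) <->
  forall C, vertex_cover e C -> (b <= \sum_(i in C) a 0%R i)%N.
Proof.
rewrite -minimal_coverP => [|A B AB]; last first.
  rewrite [leqRHS](big_setID A) /= (finset.setIidPr AB); exact: leq_addr.
have dotE C : dotp (natv R (row_mx a (const_mx b : 'rV_1)))
    (row_mx (incidence_vector R C) (const_mx (-1))) =
    (\sum_(i in C) a 0%R i)%N%:R - b%:R.
  rewrite /dotp big_split_ord big_ord1 /= /natv map_row_mx !row_mxEr !mxE mulrN1.
  congr (_ - _); rewrite natr_sum [RHS]big_mkcond /=; apply: eq_bigr => i _.
  rewrite !row_mxEl incidence_vectorE !mxE.
  by case: (i \in C); rewrite ?mulr1 ?mulr0.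
split=> [[_ H] C /H|H]; first by rewrite dotE subr_ge0 ler_nat.
split=> [i|C /H]; first by rewrite mxE ler0n.
by rewrite dotE subr_ge0 ler_nat.
Qed.

Definition indicator A : 'rV[nat]_n := \row_i (i \in A : nat).

(** The link between cone and graph: the coordinates of the indicator over a cover sum to the size
    of the trace of the cover on [A]. *)
Lemma simis_cone_indicator (R : realType) A b :
  simis_cone R e (natv R (row_mx (indicator A) (const_mx b))) <->
  (b <= alpha0 (induced e A))%N.
Proof.
rewrite simis_cone_natv alpha0_induced_geP.
suff E C : (\sum_(i in C) indicator A 0%R i)%N = #|C :&: A|.
  by split=> H C /H; rewrite E.
rewrite -sum1_card [RHS]big_mkcond [LHS]big_mkcond; apply: eq_bigr => i _.
by rewrite !inE mxE; case: (i \in C); case: (i \in A).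
Qed.

Lemma indicator_eq0 A : indicator A = 0 -> A = finset.set0.
Proof.
move/rowP => A0; apply/setP => i; have := A0 i.
by rewrite !mxE !inE; case: (i \in A).
Qed.

Lemma indicator0 : indicator finset.set0 = 0.
Proof. by apply/rowP => i; rewrite !mxE inE. Qed.

Lemma indicatorU A B : [disjoint A & B] ->
  indicator (A :|: B) = indicator A + indicator B.
Proof.
move=> /disjointFr dAB; apply/rowP => i; rewrite !mxE !inE.
by have := dAB i; case: (i \in A) => [-> //|_]; case: (i \in B).
Qed.

Lemma indicatorK a : (forall i, a 0 i = 0%N \/ a 0 i = 1%N) ->
  indicator [set i | a 0 i == 1%N]%SET = a.
Proof. by move=> a01; apply/rowP => i; rewrite mxE inE; case: (a01 i) => ->. Qed.

Lemma alpha0_induced_set0 : alpha0 (induced e finset.set0) = 0%N.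
Proof.
apply/eqP; rewrite -leqn0.
have /alpha0_induced_geP := leqnn (alpha0 (induced e finset.set0)).
move/(_ [set: 'I_n]%SET); rewrite finset.setI0 cards0; apply.
by apply/vertex_coverP => x y; rewrite inE.
Qed.

(** Without loops, the complement of [i] is a cover, and its trace on the singleton is empty. *)
Lemma alpha0_induced_set1 i : irreflexive e ->
  alpha0 (induced e [set i]%SET) = 0%N.
Proof.
move=> e_irr; apply/eqP; rewrite -leqn0.
have /alpha0_induced_geP := leqnn (alpha0 (induced e [set i]%SET)).
move/(_ (~: [set i])%SET); rewrite finset.setIC finset.setICr cards0; apply.
apply/vertex_coverP => x y exy; rewrite !inE -negb_and.
by apply: contraL exy => /andP[/eqP-> /eqP->]; rewrite e_irr.
Qed.

(** The trace of a cover on a disjoint union is the disjoint union of its traces on the two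
    parts. *)
Lemma alpha0_induced_setU A B : [disjoint A & B] ->
  (alpha0 (induced e A) + alpha0 (induced e B) <=
   alpha0 (induced e (A :|: B)))%N.
Proof.
move=> dAB; apply/alpha0_induced_geP => C covC.
rewrite finset.setIUr cardsU -finset.setIIr (disjoint_setI0 dAB).
rewrite finset.setI0 cards0 subn0.
by apply: leq_add; exact: (alpha0_induced_geP _ _ _).1 (leqnn _) C covC.
Qed.

Lemma leq_alpha0_setD1 A i :
  (alpha0 (induced e A) <= (alpha0 (induced e (A :\ i))).+1)%N.
Proof.
rewrite -add1n -leq_subLR; apply/alpha0_induced_geP => C covC.
rewrite leq_subLR; have /alpha0_induced_geP := leqnn (alpha0 (induced e A)).
move=> /(_ C covC) /leq_trans; apply.
rewrite (cardsD1 i) -finset.setIDA; apply: leq_add => //.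
by case: (_ \in _).
Qed.

Lemma rowvec_split (h : 'rV[nat]_(n + 1)) :
  exists a b, h = row_mx a (const_mx b).
Proof.
exists (lsubmx h), (rsubmx h 0 0); rewrite -[LHS]hsubmxK; congr row_mx.
by apply/rowP => i; rewrite !mxE ord1.
Qed.

Lemma indecomposable_indicator (R : realType) S b : irreflexive e ->
  indecomposable (fun h => simis_cone R e (natv R h))
    (row_mx (indicator S) (const_mx b)) <->
  irreducible_graph (induced e S) /\ b = alpha0 (induced e S).
Proof.
move=> e_irr; split=> [[/simis_cone_indicator b_le hn0 hP]|].
  have bE : b = alpha0 (induced e S).
    apply/eqP; rewrite eqn_leq b_le leqNgt; apply/negP => b_lt.
    have [S0|[i iS]] := set_0Vmem S.
      by rewrite S0 alpha0_induced_set0 in b_lt.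
    (* Split off the vertex [i] with last coordinate 0. Removing it lowers [alpha0] by at most 1,
       and [b] is strictly below [alpha0] of [S], so the other summand stays in the cone. *)
    case: (hP (row_mx (indicator [set i]%SET) (const_mx 0))
              (row_mx (indicator (S :\ i)) (const_mx b))).
    - by apply/simis_cone_indicator.
    - apply/simis_cone_indicator; rewrite -ltnS.
      exact: leq_trans b_lt (leq_alpha0_setD1 _ _).
    - rewrite add_row_mx -indicatorU ?finset.setD1K //; last first.
        by rewrite disjoints1 !inE eqxx.
      by congr row_mx; apply/rowP => j; rewrite !mxE add0r.
    - rewrite -[X in _ = X]row_mx0 => /eq_row_mx[/indicator_eq0/setP/(_ i)].
      by rewrite !inE eqxx.
    (* If the other summand vanishes, [S] is a single vertex with covering number 0, which leaves no
       room for [b] below it. *)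
    - rewrite -[X in _ = X]row_mx0 => /eq_row_mx[/indicator_eq0 Si0 _].
      have SE : S = [set i]%SET by rewrite -(finset.setD1K iS) Si0 finset.setU0.
      by rewrite SE alpha0_induced_set1 in b_lt.
  split=> //; split.
    rewrite card_sig lt0n; apply: contra hn0 => /eqP S0.
    have {}S0 : S = finset.set0 by apply: cards0_eq; rewrite -S0; apply: eq_card.
    rewrite bE S0 alpha0_induced_set0 indicator0 -row_mx0; apply/eqP; congr row_mx.
  case=> S1 [S2 [S1n0 S2n0 S12 S12T alphaE]].
  have dA : [disjoint val @: S1 & val @: S2].
    by rewrite (imset_disjoint val_inj).
  have SE : S = val @: S1 :|: val @: S2.
    rewrite -imsetU S12T; apply/setP => x; apply/idP/imsetP => [xS|[y _ ->]].
      by exists (Sub x xS).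
    exact: valP.
  (* A reduction of the graph, with the covering number of each part as last coordinate, would
     decompose the vector. *)
  case: (hP (row_mx (indicator (val @: S1))
               (const_mx (alpha0 (induced e (val @: S1)))))
            (row_mx (indicator (val @: S2))
               (const_mx (alpha0 (induced e (val @: S2)))))).
  - exact/simis_cone_indicator.
  - exact/simis_cone_indicator.
  - rewrite add_row_mx -indicatorU // -SE; congr row_mx.
    by apply/rowP => j; rewrite !mxE bE alphaE !alpha0_induced_induced.
  - rewrite -[X in _ = X]row_mx0 => /eq_row_mx[/indicator_eq0/eqP].
    by rewrite imset_eq0 (negbTE S1n0).
  - rewrite -[X in _ = X]row_mx0 => /eq_row_mx[/indicator_eq0/eqP].
    by rewrite imset_eq0 (negbTE S2n0).
case=> -[Sn0 irr] bE; split.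
- by apply/simis_cone_indicator; rewrite bE.
- apply/eqP; rewrite -[X in _ = X]row_mx0 => /eq_row_mx[/indicator_eq0 S0 _].
  by move: Sn0; rewrite card_sig S0 (eq_card0 (A := _)) // => x; rewrite !inE.
move=> h1 h2; have [a1 [b1 ->]] := rowvec_split h1.
have [a2 [b2 ->]] := rowvec_split h2 => h1M h2M.
rewrite add_row_mx => /eq_row_mx[/rowP aE /rowP/(_ 0)]; rewrite !mxE => b12.
(* The coordinates of the two summands add up to 0 or 1, so the summands are indicators of sets that
   partition [S]. *)
have a01 i : (a1 0%R i + a2 0%R i)%N = (i \in S) :> nat by have := aE i; rewrite !mxE.
have a1_01 i : a1 0 i = 0%N \/ a1 0 i = 1%N.
  by have := a01 i; case: (i \in S) => /=; lia.
have a2_01 i : a2 0 i = 0%N \/ a2 0 i = 1%N.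
  by have := a01 i; case: (i \in S) => /=; lia.
pose A1 := [set i | a1 0 i == 1%N]%SET; pose A2 := [set i | a2 0 i == 1%N]%SET.
have a1E : a1 = indicator A1 by rewrite indicatorK.
have a2E : a2 = indicator A2 by rewrite indicatorK.
have dA : [disjoint A1 & A2].
  rewrite -setI_eq0; apply/eqP/setP => i; rewrite !inE; have := a01 i.
  by case: (a1_01 i) (a2_01 i) => -> [] ->; case: (i \in S).
have SE : S = A1 :|: A2.
  apply/setP => i; rewrite !inE; have := a01 i.
  by case: (a1_01 i) (a2_01 i) => -> [] ->; case: (i \in S).
move: h1M h2M; rewrite a1E a2E => /simis_cone_indicator le1 /simis_cone_indicator le2.
(* On an empty part the cone also forces the last coordinate to be 0, so the whole summand
   vanishes. *)
have [A10|A1n0] := eqVneq A1 finset.set0.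
  left; move: le1; rewrite A10 alpha0_induced_set0 leqn0 indicator0 => /eqP->.
  exact: row_mx0.
have [A20|A2n0] := eqVneq A2 finset.set0.
  right; move: le2; rewrite A20 alpha0_induced_set0 leqn0 indicator0 => /eqP->.
  exact: row_mx0.
have leU := alpha0_induced_setU dA; rewrite -SE in leU.
(* Superadditivity gives one inequality; the other is [b = b1 + b2] with each [bi] at most the
   covering number of its part. *)
have alphaE : (alpha0 (induced e S) =
    alpha0 (induced e A1) + alpha0 (induced e A2))%N.
  by apply/eqP; rewrite eqn_leq leU andbT -bE b12; apply: leq_add.
have imE A : A \subset S -> val @: (val @^-1: A : {set {x | x \in S}}) = A.
  move=> /fintype.subsetP AS; apply/setP => x; apply/imsetP/idP => [[y]|xA].
    by rewrite inE => ? ->.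
  by exists (Sub x (AS x xA)); rewrite ?inE.
have sA1 : A1 \subset S by rewrite SE finset.subsetUl.
have sA2 : A2 \subset S by rewrite SE finset.subsetUr.
case: irr; exists (val @^-1: A1), (val @^-1: A2); split.
- by rewrite -(imset_eq0 val) imE.
- by rewrite -(imset_eq0 val) imE.
- by rewrite -(imset_disjoint val_inj) !imE.
- apply/setP => x; rewrite !inE; have /setP/(_ (val x)) := SE.
  by rewrite !inE (valP x).
- by rewrite !alpha0_induced_induced !imE.
Qed.

End SimisCone.

Theorem corollary3p12 (R : realType) (n : nat) (e : rel 'I_n)
    (e_sym : symmetric e) (e_irr : irreflexive e)
    (a : 'rV[nat]_n) (a01 : forall i, a 0 i = 0%N \/ a 0 i = 1%N) (b : nat) :
  row_mx a (const_mx b) \in minimal_hilbert_basis (simis_cone R e) <->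
  irreducible_graph (induced e [set i | a 0 i == 1%N]%SET) /\
  b = alpha0 (induced e [set i | a 0 i == 1%N]%SET).
Proof.
rewrite -(indecomposable_indicator R _ b e_irr) indicatorK //.
by rewrite simis_cone_polyhedral; apply: mem_minimal_hilbert_basis.
Qed.
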